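(* Let $G$ be a group with a presentation $G=\langle X\mid R\rangle$, where $X$ is finite and $R$ is not necessarily finite, and let $\phi\colon F(X)\to G$ be the canonical epimorphism. (1) Let $\Gamma$ be an $X$-regular connected $X$-graph with $n$ vertices ($n\in\mathbb N$), and let $v_0$ be a base-vertex of $\Gamma$. Assume that $\Gamma$ fulfills the defining relators $R$. Then $\phi(L(\Gamma,v_0))$ is a subgroup of $G$ of index $[G:\phi(L(\Gamma,v_0))]=n$. (2) Let $H\le G$ be a subgroup of index $[G:H]=n\in\mathbb N$. Then there exists a based $X$-graph $(\Gamma,v_0)$, unique up to a canonical isomorphism of based $X$-graphs, such that: (i) $\Gamma$ is $X$-regular and connected; (ii) $\Gamma$ fulfills the defining relators $R$; (iii) $\Gamma$ has $n$ vertices; (iv) $\phi(L(\Gamma,v_0))=H$. In the situation of (2), denote $(\Gamma,v_0)$ by $(\Gamma_{X,R}(H),1_H)$ (the subgroup graph of $H$ with respect to $X$ and $R$). Then $\Gamma_{X,R}(H)=\Gamma_X(H')$, where $H':=L(\Gamma_{X,R}(H),1_H)\le F(X)$.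
   Context: $F(X)$ is the free group on $X$, realized as the set of freely reduced words in $X\cup X^{-1}$; $R\subseteq F(X)$; $N=\langle\!\langle R\rangle\!\rangle_{F(X)}$ is the normal closure of $R$ in $F(X)$, $G\cong F(X)/N$, and $\phi\colon F(X)\to G$ is the canonical epimorphism. An $X$-graph is a directed graph $\Gamma$ (loops and multiple edges allowed) in which every directed edge $e$, with origin $o(e)$ and terminus $t(e)$, carries a label $\mu(e)\in X$. A morphism of $X$-graphs maps vertices to vertices and directed edges to directed edges, preserving labels, origins and termini; a morphism of based $X$-graphs also maps base-vertex to base-vertex. $\widehat\Gamma$ is obtained from $\Gamma$ by adding, for each edge $e$, a formal inverse $e^{-1}$ with $o(e^{-1})=t(e)$, $t(e^{-1})=o(e)$, $\mu(e^{-1})=\mu(e)^{-1}$ (and $(e^{-1})^{-1}=e$). A path $p$ in $\Gamma$ is a sequence $e_1,\dots,e_k$ of edges of $\widehat\Gamma$ with $o(e_i)=t(e_{i-1})$; $o(p)=o(e_1)$, $t(p)=t(e_k)$, $\mu(p)=\mu(e_1)\cdots\mu(e_k)$; a single vertex $v$ is also a path, with empty label. A path is reduced if it has no subpath $e,e^{-1}$ with $e$ an edge of $\widehat\Gamma$. The language is $L(\Gamma,v)=\{\mu(p)\mid p$ a reduced path in $\Gamma$ with $o(p)=t(p)=v\}$. $\Gamma$ is $X$-regular if for every vertex $v$ and every $x\in X\cup X^{-1}$ there is exactly one edge in $\widehat\Gamma$ with origin $v$ and label $x$ (then the words in $L(\Gamma,v)$ are freely reduced and $L(\Gamma,v)$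 is a subgroup of $F(X)$). $\Gamma$ fulfills the defining relators $R$ if for every vertex $v$ and every $r\in R$, each reduced path with origin $v$ and label $r$ has terminus $v$. $\Gamma$ is folded if for each vertex $v$ and each $x\in X$ there is at most one edge with origin $v$ and label $x$, and at most one edge with terminus $v$ and label $x$. $\Gamma$ is a core graph with respect to $v$ if $\Gamma$ is the union of all reduced paths from $v$ to $v$. For a subgroup $H'\le F(X)$, $\Gamma_X(H')$ (with base-vertex $1_{H'}$) is the based $X$-graph, unique up to isomorphism of based $X$-graphs, that is folded, connected, a core graph with respect to its base-vertex, and has language $H'$ at its base-vertex. Equality of subgroup graphs is understood up to isomorphism of based $X$-graphs. *)

(* Defs.v *)
From HB Require Import structures.
From mathcomp Require Import all_boot.
From mathcomp Require Import boolp classical_sets functions cardinality.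

Set Implicit Arguments.
Unset Strict Implicit.
Unset Printing Implicit Defensive.

Local Open Scope classical_set_scope.
Local Open Scope card_scope.

(* [(x, false)] stands for x and [(x, true)] for its formal inverse; this is
   used both for the letters of X together with X^-1 and for the edges of the
   graph obtained by adding formal inverses of edges. *)
Definition formal_inv (T : Type) (a : T * bool) : T * bool := (a.1, ~~ a.2).

Definition reduced (T : Type) (s : seq (T * bool)) : Prop :=
  forall (s1 s2 : seq (T * bool)) (a : T * bool),
    s <> s1 ++ [:: a, formal_inv a & s2].

Lemma formal_invK (T : Type) : involutive (@formal_inv T).
Proof. by case=> x b; rewrite /formal_inv /= negbK. Qed.

Section FreeGroup.
Variable X : eqType.

Definition word := seq (X * bool).

Implicit Types (a b : X * bool) (u v w : word).

Definition freely_reduced w : bool := sorted (fun a b => b != formal_inv a) w.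

Lemma freely_reducedP w : reflect (reduced w) (freely_reduced w).
Proof.
apply: (iffP idP).
  move=> + s1 s2 a Ew; rewrite /freely_reduced {}Ew; case: s1 => [|c s1] /=.
    by rewrite eqxx.
  by rewrite cat_path /= eqxx /= !andbF.
elim: w => [//|a [//|b w] IH] H /=.
have IH' : freely_reduced (b :: w).
  by apply: IH => s1 s2 c E; apply: (H (a :: s1) s2 c); rewrite E.
apply/andP; split=> //.
by apply/eqP => E; apply: (H [::] w a); rewrite E.
Qed.

Definition cons_cancel a w : word :=
  if w is b :: w' then if b == formal_inv a then w' else a :: w else [:: a].

Definition cat_cancel u v : word := foldr cons_cancel v u.

Definition word_inv w : word := rev (map (@formal_inv X) w).

Lemma cons_cancel_reduced a w :
  freely_reduced w -> freely_reduced (cons_cancel a w).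
Proof.
case: w => //= b w Hw; case: eqP => [_|/eqP ba] /=; last by rewrite ba.
exact: path_sorted Hw.
Qed.

Lemma cat_cancel_reduced u v :
  freely_reduced v -> freely_reduced (cat_cancel u v).
Proof. by move=> Hv; elim: u => //= a u; apply: cons_cancel_reduced. Qed.

Lemma cons_cancelK a w :
  freely_reduced w -> cons_cancel a (cons_cancel (formal_inv a) w) = w.
Proof.
case: w => [|b w] /=; first by rewrite eqxx.
rewrite formal_invK; case: eqP => [->|_] /=; last by rewrite eqxx.
by case: w => //= c w /andP[/negPf ->].
Qed.

Lemma cons_cancel_id a w : freely_reduced (a :: w) -> cons_cancel a w = a :: w.
Proof. by case: w => //= b w /andP[/negPf ->]. Qed.

Lemma cat_cancel_cons a u v : freely_reduced v ->
  cat_cancel (cons_cancel a u) v = cons_cancel a (cat_cancel u v).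
Proof.
case: u => //= b u Hv; case: eqP => [->|//].
by rewrite cons_cancelK ?cat_cancel_reduced.
Qed.

Lemma cat_cancelA u v w : freely_reduced w ->
  cat_cancel u (cat_cancel v w) = cat_cancel (cat_cancel u v) w.
Proof. by move=> Hw; elim: u => //= a u ->; rewrite cat_cancel_cons. Qed.

Lemma cat_cancelw0 w : freely_reduced w -> cat_cancel w [::] = w.
Proof.
elim: w => //= a w IH Hw.
by rewrite IH ?cons_cancel_id //; exact: path_sorted Hw.
Qed.

Lemma word_inv_reduced w : freely_reduced w -> freely_reduced (word_inv w).
Proof.
rewrite /freely_reduced /word_inv rev_sorted sorted_map.
apply: sub_sorted => a b /= /eqP ba; apply/eqP => E; apply: ba.
by rewrite -(formal_invK b) E formal_invK.
Qed.

Lemma cat_cancelVw w v : freely_reduced v ->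
  cat_cancel (word_inv w) (cat_cancel w v) = v.
Proof.
move=> Hv; elim: w => //= a w IH.
rewrite /word_inv /= rev_cons -cats1 /cat_cancel foldr_cat /=.
rewrite -[X in cons_cancel (formal_inv a) (cons_cancel X _)]formal_invK.
by rewrite cons_cancelK // cat_cancel_reduced.
Qed.

Lemma word_invK : involutive word_inv.
Proof.
move=> w; rewrite /word_inv map_rev revK -map_comp -[RHS]map_id.
by apply: eq_map => a /=; rewrite formal_invK.
Qed.

End FreeGroup.

(* F(X), realized as the set of freely reduced words *)
Record free_group (X : eqType) := FreeWord {
  fg_word :> word X;
  fg_wordP : freely_reduced fg_word }.

HB.instance Definition _ (X : eqType) := [isSub for @fg_word X].
HB.instance Definition _ (X : choiceType) := [Choice of free_group X by <:].

Section FreeGroupStructure.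
Variable X : choiceType.

Definition fg_one : free_group X := @FreeWord X [::] isT.
Definition fg_mul (u v : free_group X) : free_group X :=
  FreeWord (cat_cancel_reduced u (fg_wordP v)).
Definition fg_inv (u : free_group X) : free_group X :=
  FreeWord (word_inv_reduced (fg_wordP u)).

Lemma fg_mulA : associative fg_mul.
Proof. by move=> u v w; apply: val_inj; apply: cat_cancelA (fg_wordP w). Qed.

Lemma fg_mul1g : left_id fg_one fg_mul.
Proof. by move=> u; apply: val_inj. Qed.

Lemma fg_mulg1 : right_id fg_one fg_mul.
Proof. by move=> u; apply: val_inj; apply: cat_cancelw0 (fg_wordP u). Qed.

Lemma fg_mulVg : left_inverse fg_one fg_inv fg_mul.
Proof.
move=> u; apply: val_inj => /=.
by rewrite -[X in cat_cancel _ X](cat_cancelw0 (fg_wordP u)) cat_cancelVw.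
Qed.

Lemma fg_mulgV : right_inverse fg_one fg_inv fg_mul.
Proof.
move=> u; rewrite -[X in fg_mul X _](_ : fg_inv (fg_inv u) = u) ?fg_mulVg //.
by apply: val_inj; apply: word_invK.
Qed.

HB.instance Definition _ := isGroup.Build (free_group X)
  fg_mulA fg_mul1g fg_mulg1 fg_mulVg fg_mulgV.

(* the element of F(X) represented by a word, i.e. its free reduction *)
Definition fg_of_word (w : word X) : free_group X :=
  FreeWord (@cat_cancel_reduced X w [::] isT).

End FreeGroupStructure.

Section Groups.
Local Open Scope group_scope.

Definition is_subgroup (G : groupType) (H : set G) : Prop :=
  group_closed [in H].

Definition is_normal_subgroup (G : groupType) (N : set G) : Prop :=
  is_subgroup N /\ (forall g x, N x -> N (x ^ g)).

Definition normal_closure (G : groupType) (R : set G) : set G :=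
  smallest (@is_normal_subgroup G) R.

Definition right_cosets (G : groupType) (H : set G) : set (set G) :=
  [set [set h * g | h in H] | g in [set: G]].

Definition has_index (G : groupType) (H : set G) (n : nat) : Prop :=
  right_cosets H #= `I_n.

(* G = < X | R > with canonical epimorphism phi *)
Definition is_presentation (X : choiceType) (R : set (free_group X))
    (G : groupType) (phi : {multiplicative free_group X -> G}) : Prop :=
  set_surj setT setT phi /\ [set w | phi w = 1] = normal_closure R.

End Groups.

Record xgraph (X : Type) := XGraph {
  vertex : Type;
  edge : Type;
  origin : edge -> vertex;
  terminus : edge -> vertex;
  label : edge -> X }.

Section XGraph.
Variables (X : choiceType) (Gam : xgraph X).

Implicit Types (u v : vertex Gam) (e : edge Gam * bool)
  (p : seq (edge Gam * bool)).

Definition hat_origin e : vertex Gam :=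
  if e.2 then terminus e.1 else origin e.1.
Definition hat_terminus e : vertex Gam :=
  if e.2 then origin e.1 else terminus e.1.
Definition hat_label e : X * bool := (label e.1, e.2).

Fixpoint is_path u p v : Prop :=
  if p is e :: p' then hat_origin e = u /\ is_path (hat_terminus e) p' v
  else u = v.

Definition path_label p : word X := map hat_label p.

Definition language v : set (word X) :=
  [set path_label p | p in [set p | is_path v p v /\ reduced p]].

(* Elements of F(X) represented by the words in the language. For an
   X-regular or folded graph these words are already freely reduced. *)
Definition language_fg v : set (free_group X) :=
  [set fg_of_word w | w in language v].

Definition connected : Prop := forall u v, exists p, is_path u p v.

Definition regular : Prop := forall v (a : X * bool),
  exists! e, hat_origin e = v /\ hat_label e = a.

Definition fulfills (R : set (free_group X)) : Prop :=
  forall u v p (r : free_group X), R r ->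
    is_path u p v -> reduced p -> path_label p = r -> v = u.

Definition folded : Prop := forall e e' : edge Gam, label e = label e' ->
  (origin e = origin e' -> e = e') /\ (terminus e = terminus e' -> e = e').

Definition core v : Prop :=
  (forall u, exists p q,
     [/\ is_path v p u, is_path u q v & reduced (p ++ q)]) /\
  (forall e : edge Gam, exists p q b,
     is_path v (p ++ (e, b) :: q) v /\ reduced (p ++ (e, b) :: q)).

(* (Gam, v) is the graph Gamma_X(H') of a subgroup H' of F(X) *)
Definition is_subgroup_graph (H' : set (free_group X)) v : Prop :=
  [/\ folded, connected, core v & language v = [set val w | w in H']].

End XGraph.

Definition is_based_morphism (X : Type) (Gam : xgraph X) (v : vertex Gam)
    (Del : xgraph X) (w : vertex Del)
    (f : (vertex Gam -> vertex Del) * (edge Gam -> edge Del)) : Prop :=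
  [/\ forall e, origin (f.2 e) = f.1 (origin e),
      forall e, terminus (f.2 e) = f.1 (terminus e),
      forall e, label (f.2 e) = label e &
      f.1 v = w].

Definition is_based_iso (X : Type) (Gam : xgraph X) (v : vertex Gam)
    (Del : xgraph X) (w : vertex Del)
    (f : (vertex Gam -> vertex Del) * (edge Gam -> edge Del)) : Prop :=
  [/\ is_based_morphism v w f, bijective f.1 & bijective f.2].

Section SubgroupGraph.
Variables (X : choiceType) (R : set (free_group X)) (G : groupType).
Variable phi : {multiplicative free_group X -> G}.

(* (Gam, v) is the subgroup graph of H, with n = [G : H], with respect to X
   and R *)
Definition is_relative_subgroup_graph (H : set G) (n : nat) (Gam : xgraph X)
    (v : vertex Gam) : Prop :=
  [/\ regular Gam /\ connected Gam,
      fulfills Gam R,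
      [set: vertex Gam] #= `I_n &
      phi @` language_fg v = H].

End SubgroupGraph.

(* Main.v *)
Require Import Defs.
From mathcomp Require Import all_boot.
From mathcomp Require Import boolp classical_sets functions cardinality.

(** A path of a graph labelled by X spells a word, and in a folded graph two
paths with a common origin and a common label coincide.  Cancelling a a^-1 in
the label of a walk just removes a backtracking piece, so a folded graph
carries a partial right action of the free group F(X) on its vertices: g sends
u to v when [reads u g v].  The language at v is the stabiliser of v, a
subgroup.  All the statements are read off from this action.

In a regular graph every letter can be read everywhere, so F(X) really acts.
When the graph fulfills R, each r in R acts trivially; the elements acting
trivially form a normal subgroup, which therefore contains the kernel of phi
([kernel_trivial]).  Hence G acts, transitively by connectedness, and the
stabiliser of v is phi(L(Gam, v)): its index is the number of vertices
([index_language]), and L(Gam, v) is the full preimage of phi(L(Gam, v))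
([language_preimage]).  Conversely the Schreier graph of the action of G on
the right cosets of H is a regular connected graph fulfilling R, in which H is
the stabiliser of the coset H ([relative_subgroup_graph_exists]).

Uniqueness, and the comparison with the subgroup graph of L(Gam, v), come
from one fact ([based_iso_of_language]): a folded core graph is determined by
its language at the base-vertex.  It applies to the graphs at hand because a
finite connected regular graph is a core graph ([regular_core]): every letter
permutes the finite vertex set, so its inverse is one of its positive powers,
and any two vertices are joined by a path all of whose edges are followed
forwards.  Such paths never backtrack, so their concatenations are reduced.
The isomorphism is the only one because a based morphism from a connected
graph to a folded one is forced along paths ([based_morphism_uniq]). *)

Set Implicit Arguments.
Unset Strict Implicit.
Unset Printing Implicit Defensive.

Local Open Scope classical_set_scope.
Local Open Scope card_scope.

(** * Reading words along paths *)

Lemma fg_of_word_val {X : choiceType} (g : free_group X) : fg_of_word g = g.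
Proof. by apply: val_inj; apply: cat_cancelw0 (fg_wordP g). Qed.

Section Walks.
Context {X : choiceType} {Gam : xgraph X}.
Implicit Types (u v t : vertex Gam) (p q : seq (edge Gam * bool)).
Implicit Types (w : word X) (g h : free_group X).

(** Remembering the endpoints and the label, and forgetting the path itself,
turns walks into a relation to which the group operations of F(X) apply. *)
Definition reads u w v : Prop := exists2 p, is_path u p v & path_label p = w.

Lemma is_path_cat u p q v :
  is_path u (p ++ q) v <-> exists2 t, is_path u p t & is_path t q v.
Proof.
elim: p u => [|e p IH] u /=.
  by split=> [?|[t ->]//]; exists u.
split=> [[ou /IH[t pt qt]]|[t [ou pt] qt]]; first by exists t.
by split=> //; apply/IH; exists t.
Qed.

Lemma reads_nil u v : reads u [::] v <-> u = v.
Proof. by split=> [[[|//] //]|->]; exists [::]. Qed.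

Lemma reads_cat u w w' v :
  reads u (w ++ w') v <-> exists2 t, reads u w t & reads t w' v.
Proof.
split=> [[p pp pw]|[t [p pp <-] [q qq <-]]]; last first.
  exists (p ++ q); first by apply/is_path_cat; exists t.
  by rewrite /path_label map_cat.
have pE : p = take (size w) p ++ drop (size w) p by rewrite cat_take_drop.
rewrite pE in pp; have /is_path_cat[t pt qt] := pp; exists t.
  exists (take (size w) p) => //.
  by rewrite /path_label map_take -/(path_label p) pw take_size_cat.
exists (drop (size w) p) => //.
by rewrite /path_label map_drop -/(path_label p) pw drop_size_cat.
Qed.

Lemma reads_letter (e : edge Gam * bool) :
  reads (hat_origin e) [:: hat_label e] (hat_terminus e).
Proof. by exists [:: e]. Qed.

Lemma reads_letterP u a v : reads u [:: a] v <->
  exists e : edge Gam * bool,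
    [/\ hat_origin e = u, hat_terminus e = v & hat_label e = a].
Proof.
split=> [[[//|e [|//]] /= [ou tv] [ea]]|[e [<- <- <-]]]; first by exists e.
exact: reads_letter.
Qed.

Lemma reads_letter_inv u a v : reads u [:: a] v -> reads v [:: formal_inv a] u.
Proof.
move=> /reads_letterP[[e b] [<- <- <-]].
have := reads_letter (e, ~~ b).
by rewrite /hat_origin /hat_terminus /=; case: b.
Qed.

Lemma reads_word_inv u w v : reads u w v -> reads v (word_inv w) u.
Proof.
elim: w u => [|a w IH] u; first by move=> /reads_nil ->; apply/reads_nil.
rewrite -cat1s => /reads_cat[t ua tv].
rewrite /word_inv map_cat rev_cat; apply/reads_cat.
by exists t; [exact: IH|exact: reads_letter_inv].
Qed.

Lemma reads_inv u g v : reads u g v -> reads v (g^-1)%g u.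
Proof. exact: reads_word_inv. Qed.

Lemma reads_one u : reads u (1%g : free_group X) u.
Proof. exact/reads_nil. Qed.

(** A backtracking in the path shows up as a cancellation in its label; the
converse needs folding, see [label_reduced]. *)
Lemma reduced_of_label p : freely_reduced (path_label p) -> reduced p.
Proof.
move=> /freely_reducedP lp p1 p2 e pE.
apply: (lp (path_label p1) (path_label p2) (hat_label e)).
by rewrite pE /path_label map_cat.
Qed.

Section Folded.
Hypothesis foldGam : folded Gam.

Lemma folded_hat (e e' : edge Gam * bool) :
  hat_origin e = hat_origin e' -> hat_label e = hat_label e' -> e = e'.
Proof.
case: e e' => [e b] [e' b']; rewrite /hat_origin /hat_label /= => + [le bE].
rewrite -{}bE; have [oe te] := foldGam le.
by case: b => [/te|/oe] ->.
Qed.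

Lemma reads_inj u w v v' : reads u w v -> reads u w v' -> v = v'.
Proof.
elim: w u => [|a w IH] u; first by move=> /reads_nil -> /reads_nil.
rewrite -cat1s => /reads_cat[t /reads_letterP[e [ou <- la]] tv].
move=> /reads_cat[t' /reads_letterP[e' [ou' <- la']] tv'].
have ee' : e = e' by apply: folded_hat; rewrite ?ou ?ou' ?la ?la'.
by apply: IH tv _; rewrite ee'.
Qed.

(** If consecutive edges have opposite labels, the second edge and the formal
inverse of the first have a common origin and label, so folding identifies
them and the path backtracks. *)
Lemma label_reduced u p v :
  is_path u p v -> reduced p -> freely_reduced (path_label p).
Proof.
elim: p u => [//|e [//|e' p] IH] u /= [ou [oe' pv]] red.
apply/andP; split; last first.
  apply: (IH (hat_terminus e)) => //= p1 p2 c pE.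
  by apply: (red (e :: p1) p2 c); rewrite pE.
apply/eqP => ll; apply: (red [::] p e) => /=; congr [:: _, _ & _].
apply: folded_hat => //; rewrite oe'.
by case: (e) => f b; rewrite /hat_terminus /hat_origin /=; case: b.
Qed.

(** In a folded graph, reading a^-1 right after a leads back to where the walk
was, so one step of free reduction does not change the endpoint.  This is
what makes F(X), and not only the monoid of words, act. *)
Lemma reads_cons_cancel u a w v :
  reads u (a :: w) v -> reads u (cons_cancel a w) v.
Proof.
case: w => //= b w; case: eqP => // ->.
rewrite -cat1s => /reads_cat[t ua]; rewrite -cat1s => /reads_cat[t' tt' wv].
by rewrite (reads_inj (reads_letter_inv ua) tt').
Qed.

Lemma reads_cat_cancel u w t w' v :
  reads u w t -> reads t w' v -> reads u (cat_cancel w w') v.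
Proof.
move=> + tv; elim: w u => [|a w IH] u; first by move=> /reads_nil ->.
rewrite -cat1s => /reads_cat[s us st] /=; apply: reads_cons_cancel.
by rewrite -cat1s; apply/reads_cat; exists s => //; apply: IH.
Qed.

Lemma reads_mul u g t h v :
  reads u g t -> reads t h v -> reads u (g * h)%g v.
Proof. exact: reads_cat_cancel. Qed.

Lemma reads_fg_of_word u w v : reads u w v -> reads u (fg_of_word w) v.
Proof. by move=> uv; apply: reads_cat_cancel uv _; apply/reads_nil. Qed.

(** The language is a stabiliser.  A walk spelling a freely reduced word is
automatically reduced, which is why no condition on the path remains. *)
Lemma language_fgP v g : language_fg v g <-> reads v g v.
Proof.
split=> [[w [p [pp _] <-] <-]|[p pp pg]].
  by apply: reads_fg_of_word; exists p.
exists g; last exact: fg_of_word_val.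
by exists p => //; split=> //; apply: reduced_of_label; rewrite pg fg_wordP.
Qed.

Lemma language_val v : language v = [set val g | g in language_fg v].
Proof.
rewrite eqEsubset; split=> [w [p [pp rp] <-]|w [g /language_fgP[p pp pg] <-]].
  exists (FreeWord (label_reduced pp rp)) => //.
  by apply/language_fgP; exists p.
by exists p => //; split=> //; apply: reduced_of_label; rewrite pg fg_wordP.
Qed.

End Folded.
End Walks.

Lemma is_subgroupP (G : groupType) (H : set G) : is_subgroup H <->
  H 1%g /\ forall x y, H x -> H y -> H (x / y)%g.
Proof.
split=> [[H1 HB]|[H1 HB]]; split.
- exact: set_mem H1.
- by move=> x y /mem_set Hx /mem_set Hy; apply: set_mem; apply: HB.
- exact: mem_set H1.
- by move=> x y /set_mem Hx /set_mem Hy; apply: mem_set; apply: HB.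
Qed.

Lemma language_subgroup {X : choiceType} {Gam : xgraph X} (v : vertex Gam) :
  folded Gam -> is_subgroup (language_fg v).
Proof.
move=> fG; apply/is_subgroupP; split.
  by apply/(language_fgP fG); exact: reads_one.
move=> x y /(language_fgP fG) rx /(language_fgP fG) ry.
by apply/(language_fgP fG)/(reads_mul fG rx)/reads_inv.
Qed.

(** * Rigidity of based morphisms *)

Section Morphisms.
Context {X : choiceType} {Gam Del : xgraph X}.
Variables (v0 : vertex Gam) (w0 : vertex Del).

Lemma morphism_reads (f : (vertex Gam -> vertex Del) * (edge Gam -> edge Del))
    u w v :
  is_based_morphism v0 w0 f -> reads u w v -> reads (f.1 u) w (f.1 v).
Proof.
move=> [fo ft fl _] [p pp <-]; elim: p u pp => [|[e b] p IH] u /=.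
  by move=> ->; apply/reads_nil.
move=> [<- pv]; rewrite -cat1s; apply/reads_cat.
exists (f.1 (hat_terminus (e, b))); last exact: IH.
apply/reads_letterP; exists (f.2 e, b).
by rewrite /hat_origin /hat_terminus /hat_label /= fl fo ft; case: (b).
Qed.

(** The image of a vertex u is reached from the base-vertex by the label of any
path from the base-vertex to u, whatever the morphism; the image of an edge is
then given by its origin and its label. *)
Lemma based_morphism_uniq f g : connected Gam -> folded Del ->
  is_based_morphism v0 w0 f -> is_based_morphism v0 w0 g -> f = g.
Proof.
move=> cG fD mf mg; have [fo _ fl fv] := mf; have [go _ gl gv] := mg.
have fg1 : f.1 = g.1.
  apply/funext => u; have [p pu] := cG v0 u.
  have r : reads v0 (path_label p) u by exists p.
  have := morphism_reads mf r; rewrite fv => rf.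
  have := morphism_reads mg r; rewrite gv => rg.
  exact: (reads_inj fD) rf rg.
rewrite [f]surjective_pairing [g]surjective_pairing fg1; congr pair.
apply/funext => e.
have [+ _] := fD (f.2 e) (g.2 e) (etrans (fl e) (esym (gl e))).
by apply; rewrite fo go fg1.
Qed.

End Morphisms.

(** * A folded core graph is determined by its language *)

Section Matching.
Context {X : choiceType}.

(** The graph of the isomorphism to be built, as a relation symmetric in the
two graphs: the inverse then comes from exchanging their roles. *)
Definition matched {Gam Del : xgraph X} (v0 : vertex Gam) (w0 : vertex Del)
    (u : vertex Gam) (u' : vertex Del) : Prop :=
  exists2 g : free_group X, reads v0 g u & reads w0 g u'.

Definition matched_edge {Gam Del : xgraph X} (v0 : vertex Gam)
    (w0 : vertex Del) (e : edge Gam) (e' : edge Del) : Prop :=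
  [/\ label e' = label e, matched v0 w0 (origin e) (origin e') &
      matched v0 w0 (terminus e) (terminus e')].

Section OneSide.
Context {Gam Del : xgraph X} (v0 : vertex Gam) (w0 : vertex Del).
Hypotheses (foldGam : folded Gam) (foldDel : folded Del).
Hypothesis eqL : language_fg v0 = language_fg w0.

Lemma matchedC u u' : matched v0 w0 u u' -> matched w0 v0 u' u.
Proof. by case=> g; exists g. Qed.

Lemma matched_edgeC e e' : matched_edge v0 w0 e e' -> matched_edge w0 v0 e' e.
Proof. by case=> le oe te; split=> //; apply: matchedC. Qed.

(** If g and h lead to the same vertex of the first graph, then g / h is in
the common language, so that it fixes the base-vertex of the second graph;
reading (g / h) * h = g there ends where h ends. *)
Lemma matched_inj u a b : matched v0 w0 u a -> matched v0 w0 u b -> a = b.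
Proof.
move=> [g vg wg] [h vh wh].
have : language_fg v0 (g / h)%g.
  exact/(language_fgP foldGam)/(reads_mul foldGam vg)/reads_inv.
rewrite eqL => /(language_fgP foldDel) wgh.
have := reads_mul foldDel wgh wh.
by rewrite mulgVK => /(reads_inj foldDel wg).
Qed.

Lemma matched_edge_inj e a b :
  matched_edge v0 w0 e a -> matched_edge v0 w0 e b -> a = b.
Proof.
move=> [la oa _] [lb ob _]; have [+ _] := foldDel (etrans la (esym lb)).
by apply; apply: matched_inj oa ob.
Qed.

(** A reduced loop through u has its label in the language, so it can be read
in the other graph as well, and u corresponds to the vertex reached there
halfway. *)
Lemma matched_loop u p q : is_path v0 p u -> is_path u q v0 ->
  reduced (p ++ q) ->
  exists2 u', matched v0 w0 u u' & reads u' (path_label q) w0.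
Proof.
move=> pu qv red.
have pqv : is_path v0 (p ++ q) v0 by apply/is_path_cat; exists u.
have lred := label_reduced foldGam pqv red.
have : language_fg v0 (FreeWord lred).
  by apply/(language_fgP foldGam); exists (p ++ q).
rewrite eqL => /(language_fgP foldDel) /=.
rewrite /path_label map_cat => /reads_cat[u' wu uw]; exists u' => //.
have pred : freely_reduced (path_label p).
  move: lred; rewrite /path_label map_cat /freely_reduced.
  by case: (map _ p) => //= a s; rewrite cat_path => /andP[].
by exists (FreeWord pred) => //; exists p.
Qed.

Hypothesis coreGam : core v0.

Lemma matched_total u : exists u', matched v0 w0 u u'.
Proof.
have [p [q [pu qv red]]] := coreGam.1 u.
by have [u' ? _] := matched_loop pu qv red; exists u'.
Qed.

(** The edge matched with e is the one that bears the letter of e when a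
reduced loop through e is copied in the other graph; b records in which
direction the loop follows e. *)
Lemma matched_edge_total e : exists e', matched_edge v0 w0 e e'.
Proof.
have [p [q [b [pv red]]]] := coreGam.2 e.
have /is_path_cat[t pt /= [te qv]] := pv.
have [t' tt'] : exists2 t', matched v0 w0 t t' &
    reads t' (path_label ((e, b) :: q)) w0.
  by apply: matched_loop pt _ red.
rewrite /= -cat1s => /reads_cat[s' /reads_letterP[[e' b'] [oe' te' [le bb]]] _].
have ss' : matched v0 w0 (hat_terminus (e, b)) (hat_terminus (e', b')).
  have [g vg wg] := tt'.
  have redL : reads t [:: (label e, b)] (hat_terminus (e, b)).
    by apply/reads_letterP; exists (e, b).
  have redR : reads t' [:: (label e, b)] (hat_terminus (e', b')).
    by apply/reads_letterP; exists (e', b'); rewrite /hat_label /= -oe' le bb.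
  exists (g * fg_of_word [:: (label e, b)])%g.
    exact: (reads_mul foldGam vg (reads_fg_of_word foldGam redL)).
  exact: (reads_mul foldDel wg (reads_fg_of_word foldDel redR)).
move: tt'; rewrite -te -oe' => tt'.
exists e'; move: bb tt' ss' le; rewrite /hat_origin /hat_terminus /= => ->.
by case: (b).
Qed.

End OneSide.

Lemma based_iso_of_language {Gam Del : xgraph X}
    (v0 : vertex Gam) (w0 : vertex Del) :
  folded Gam -> folded Del -> core v0 -> core w0 ->
  language_fg v0 = language_fg w0 ->
  exists f, is_based_iso v0 w0 f.
Proof.
move=> fG fD cG cD eqL.
have [f1 f1P] := choice (matched_total fG fD eqL cG).
have [f2 f2P] := choice (matched_edge_total fG fD eqL cG).
have [g1 g1P] := choice (matched_total fD fG (esym eqL) cD).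
have [g2 g2P] := choice (matched_edge_total fD fG (esym eqL) cD).
have injD := matched_inj fG fD eqL.
have injG := matched_inj fD fG (esym eqL).
exists (f1, f2); split.
- split=> [e|e|e|] /=.
  + by have [_ oe _] := f2P e; apply: injD oe (f1P _).
  + by have [_ _ te] := f2P e; apply: injD te (f1P _).
  + by have [] := f2P e.
  + by apply: injD (f1P _) _; exists 1%g; exact: reads_one.
- exists g1 => u /=.
  + exact: injG (g1P _) (matchedC (f1P u)).
  + exact: injD (f1P _) (matchedC (g1P u)).
- exists g2 => e /=.
  + exact: (matched_edge_inj fD fG (esym eqL))
      (g2P _) (matched_edgeC (f2P e)).
  + exact: (matched_edge_inj fG fD eqL)
      (f2P _) (matched_edgeC (g2P e)).
Qed.

End Matching.

(** * Finite regular graphs are core graphs *)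

Lemma injective_periodic (T : Type) (f : T -> T) (x : T) :
  finite_set [set: T] -> injective f -> exists m, iter m.+1 f x = x.
Proof.
move=> finT finj; apply: contrapT => noper; apply: infinite_nat.
have ilt i j : (i < j)%N -> iter i f x <> iter j f x.
  move=> ij; rewrite -(subnKC ij) addSnnS iterD => E.
  apply: noper; exists (j - i.+1)%N.
  by elim: i {ij} (j - i.+1)%N E => [//|i IHi] k /finj; apply: IHi.
have iinj : injective (fun k => iter k f x).
  move=> i j /= E; case: (ltngtP i j) => // ij; first by case: (ilt _ _ ij).
  by case: (ilt _ _ ij).
have := inj_card_eq (A := [set: nat]) (in2W iinj).
move=> /card_esym/eq_finite_set ->.
exact: sub_finite_set finT.
Qed.

Section Regular.
Context {X : choiceType} {Gam : xgraph X}.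
Hypothesis regGam : regular Gam.
Implicit Types (u v : vertex Gam) (w : word X).

Lemma regular_folded : folded Gam.
Proof.
move=> e e' le; split=> [oe|te].
  have [c [_ cU]] := regGam (origin e) (label e, false).
  have [<-//] : (e, false) = (e', false).
  by rewrite -(cU (e, false)) ?(cU (e', false)) //; split; rewrite ?oe ?le.
have [c [_ cU]] := regGam (terminus e) (label e, true).
have [<-//] : (e, true) = (e', true).
by rewrite -(cU (e, true)) ?(cU (e', true)) //; split;
  rewrite /hat_origin /hat_label /= ?te ?le.
Qed.

Lemma regular_reads u w : exists v, reads u w v.
Proof.
elim: w u => [|a w IH] u; first by exists u; apply/reads_nil.
have [e [[ou la] _]] := regGam u a; have [v tv] := IH (hat_terminus e).
exists v; rewrite -cat1s; apply/reads_cat; exists (hat_terminus e) => //.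
by apply/reads_letterP; exists e.
Qed.

(** A sufficient condition for being reduced that, unlike reducedness itself,
is preserved by concatenation. *)
Definition positive (p : seq (edge Gam * bool)) := all (fun e => ~~ e.2) p.

Lemma positive_reduced p : positive p -> reduced p.
Proof.
move=> pp p1 p2 [e b] pE; move: pp.
by rewrite pE /positive all_cat /= => /and4P[_ /negPf-> //].
Qed.

Definition positively_connected u v :=
  exists2 p, is_path u p v & positive p.

Lemma positively_connected_trans u t v :
  positively_connected u t -> positively_connected t v ->
  positively_connected u v.
Proof.
move=> [p pt pp] [q qv qp]; exists (p ++ q).
  by apply/is_path_cat; exists t.
by rewrite /positive all_cat; apply/andP.
Qed.

Hypothesis finGam : finite_set [set: vertex Gam].

(** Moving forwards along the letter of e is an injection f of the finite
vertex set, so some positive power of f fixes the origin of e; the first of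
these steps is e itself, and the other ones form the way back. *)
Lemma positive_return (e : edge Gam) :
  positively_connected (terminus e) (origin e).
Proof.
have next u : exists v, exists2 e' : edge Gam, label e' = label e &
    origin e' = u /\ terminus e' = v.
  have [[e' b] [[ou [le be]] _]] := regGam u (label e, false).
  by rewrite be /hat_origin /= in ou; exists (terminus e'), e'.
have [f fP] := choice next.
have finj : injective f.
  move=> u u' ff; have [d ld [du tu]] := fP u.
  have [d' ld' [du' tu']] := fP u'.
  have [_ td] := regular_folded (etrans ld (esym ld')).
  by rewrite -du -du' td // tu tu'.
have fiter k u : positively_connected u (iter k f u).
  elim: k => [|k IH]; first by exists [::].
  apply: positively_connected_trans IH _.
  have [d _ [od td]] := fP (iter k f u).
  by exists [:: (d, false)] => //=; rewrite /hat_origin /hat_terminus /= od td.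
have fe : f (origin e) = terminus e.
  have [d ld [od td]] := fP (origin e).
  by have [+ _] := regular_folded ld => /(_ od) dE; rewrite -td dE.
have [m mE] := injective_periodic (origin e) finGam finj.
by rewrite -fe -[X in positively_connected _ X]mE iterSr.
Qed.

Hypothesis connGam : connected Gam.

Lemma connected_positively u v : positively_connected u v.
Proof.
have [p] := connGam u v; elim: p u => [|[e b] p IH] u /=.
  by move=> ->; exists [::].
move=> [<- /IH]; apply: positively_connected_trans.
rewrite /hat_origin /hat_terminus /=; case: b; first exact: positive_return.
by exists [:: (e, false)].
Qed.

Lemma regular_core v : core v.
Proof.
split=> [u|e].
  have [p pu pp] := connected_positively v u.
  have [q qv qp] := connected_positively u v.
  exists p, q; split=> //; apply: positive_reduced.
  by rewrite /positive all_cat; apply/andP.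
have [p pu pp] := connected_positively v (origin e).
have [q qv qp] := connected_positively (terminus e) v.
exists p, q, false; split; first by apply/is_path_cat; exists (origin e).
by apply: positive_reduced; rewrite /positive all_cat; apply/andP.
Qed.

End Regular.

(** * Images of subgroups *)

Section MultiplicativeGroupMaps.
Context {G H : groupType} (f : {multiplicative G -> H}).

Lemma multiplicative1 : f 1%g = 1%g.
Proof. by apply: (mulgI (f 1%g)); rewrite -gmulfM !mulg1. Qed.

Lemma multiplicativeV x : f (x^-1)%g = ((f x)^-1)%g.
Proof. by apply: (mulgI (f x)); rewrite -gmulfM !mulgV multiplicative1. Qed.

Lemma multiplicativeF x y : f (x / y)%g = (f x / f y)%g.
Proof. by rewrite gmulfM multiplicativeV. Qed.

Lemma image_subgroup (K : set G) :
  is_subgroup K -> is_subgroup (f @` K).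
Proof.
move=> /is_subgroupP[K1 KB]; apply/is_subgroupP; split.
  by exists 1%g => //; exact: multiplicative1.
move=> _ _ [x Kx <-] [y Ky <-]; exists (x / y)%g; first exact: KB.
exact: multiplicativeF.
Qed.

End MultiplicativeGroupMaps.

(** * Graphs fulfilling the relators of a presentation *)

Section Presentation.
Context {X : choiceType} {R : set (free_group X)} {G : groupType}.
Context {phi : {multiplicative free_group X -> G}}.
Hypothesis presG : is_presentation R phi.

Section RelativeGraph.
Context {Gam : xgraph X}.
Hypotheses (regGam : regular Gam) (fulGam : fulfills Gam R).
Let foldGam := regular_folded regGam.

(** The kernel of phi is the normal closure of R, and the elements of F(X)
fixing all vertices form a normal subgroup, which contains R because the graph
fulfills R. *)
Lemma kernel_trivial (g : free_group X) (u : vertex Gam) :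
  phi g = 1%g -> reads u g u.
Proof.
move=> g1; have : [set h | phi h = 1%g] g by [].
rewrite presG.2 => Ng.
pose T : set (free_group X) := [set h | forall u : vertex Gam, reads u h u].
suff : T g by apply.
apply: (smallest_sub (C := @is_normal_subgroup _) (G := R)) Ng => [|r Rr t].
  split=> [|x y Ty t].
    apply/is_subgroupP; split=> [t|x y Tx Ty t]; first exact: reads_one.
    exact: (reads_mul foldGam (Tx t) (reads_inv (Ty t))).
  have [s ts] := regular_reads regGam t (x^-1)%g.
  apply: (reads_mul foldGam ts); apply: (reads_mul foldGam (Ty s)).
  by have := reads_inv ts; rewrite invgK.
(* Fulfilling R only speaks of existing paths; regularity provides one. *)
have [s [p pp pr]] := regular_reads regGam t r.
have red : reduced p by apply: reduced_of_label; rewrite pr fg_wordP.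
by exists p => //; have := pp; rewrite (fulGam Rr pp red pr).
Qed.

(** The action of F(X) on the vertices factors through phi. *)
Lemma reads_of_image (g h : free_group X) (u v : vertex Gam) :
  phi g = phi h -> reads u g v -> reads u h v.
Proof.
move=> gh ug; rewrite -(mulVKg g h).
apply: (reads_mul foldGam ug); apply: kernel_trivial.
by rewrite gmulfM multiplicativeV gh mulVg.
Qed.

Lemma language_preimage (v : vertex Gam) :
  language_fg v = phi @^-1` (phi @` language_fg v).
Proof.
rewrite eqEsubset; split=> [g Lg|g [h /(language_fgP foldGam) rh hg]].
  by exists g.
exact/(language_fgP foldGam)/(reads_of_image hg).
Qed.

(** The right coset of phi(L(Gam, v)) that corresponds to u, described without
choosing a path from v to u; see [vertex_cosetE]. *)
Definition vertex_coset (v u : vertex Gam) : set G :=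
  [set phi g | g in [set g : free_group X | reads v g u]].

Lemma vertex_coset_inj (v u u' : vertex Gam) : connected Gam ->
  vertex_coset v u = vertex_coset v u' -> u = u'.
Proof.
move=> cG E; have [p pu] := cG v u.
have ru := reads_fg_of_word foldGam (ex_intro2 _ _ p pu erefl).
have : vertex_coset v u (phi (fg_of_word (path_label p))).
  by exists (fg_of_word (path_label p)).
rewrite E => -[h rh hE].
exact: (reads_inj foldGam ru (reads_of_image hE rh)).
Qed.

Lemma vertex_cosetE (v u : vertex Gam) (g : free_group X) : reads v g u ->
  vertex_coset v u = [set h * phi g | h in phi @` language_fg v]%g.
Proof.
move=> rg; rewrite eqEsubset; split=> [_ [h rh <-]|_ [_ [h Lh <-] <-]].
  exists (phi (h / g)%g); last by rewrite multiplicativeF mulgVK.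
  exists (h / g)%g => //; apply/(language_fgP foldGam).
  exact: (reads_mul foldGam rh (reads_inv rg)).
exists (h * g)%g; last exact: gmulfM.
by apply: (reads_mul foldGam _ rg); exact/(language_fgP foldGam).
Qed.

Lemma range_vertex_coset (v : vertex Gam) : connected Gam ->
  range (vertex_coset v) = right_cosets (phi @` language_fg v).
Proof.
move=> cG; rewrite eqEsubset; split=> [_ [u _ <-]|_ [x _ <-]].
  have [p pu] := cG v u.
  have ru := reads_fg_of_word foldGam (ex_intro2 _ _ p pu erefl).
  exists (phi (fg_of_word (path_label p))) => //.
  by rewrite -(vertex_cosetE ru).
have [g _ <-] := presG.1 x I.
have [u ru] := regular_reads regGam v g.
by exists u => //; rewrite (vertex_cosetE ru).
Qed.

Lemma index_language (n : nat) (v : vertex Gam) : connected Gam ->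
  [set: vertex Gam] #= `I_n -> has_index (phi @` language_fg v) n.
Proof.
move=> cG; apply: card_eq_trans; rewrite -range_vertex_coset //.
by apply: inj_card_eq => u u' _ _; apply: vertex_coset_inj.
Qed.

End RelativeGraph.

(** * Schreier graphs *)

Section Schreier.
Context {V : Type} (act : V -> G -> V).
Hypotheses (act1 : forall u, act u 1%g = u)
  (actM : forall u x y, act u (x * y)%g = act (act u x) y).

Definition letter (a : X * bool) : free_group X := fg_of_word [:: a].

(** Only the generators of X give edges: an inverse letter is read by following
an edge backwards. *)
Definition schreier_graph : xgraph X :=
  @XGraph X V (V * X) fst (fun e => act e.1 (phi (letter (e.2, false)))) snd.

Lemma letter_inv x : letter (x, true) = ((letter (x, false))^-1)%g.
Proof. exact: val_inj. Qed.

Lemma fg_of_word_cons a (w : word X) :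
  fg_of_word (a :: w) = (letter a * fg_of_word w)%g.
Proof. exact: val_inj. Qed.

Lemma actVK u x y : u = act y (x^-1)%g <-> act u x = y.
Proof. by split=> [->|<-]; rewrite -actM ?mulVg ?mulgV act1. Qed.

Lemma schreier_terminus (e : edge schreier_graph * bool) :
  hat_terminus e = act (hat_origin e) (phi (letter (hat_label e))).
Proof.
case: e => [[u x] []]; rewrite /hat_terminus /hat_origin /hat_label //=.
by rewrite letter_inv multiplicativeV; apply/actVK.
Qed.

Lemma schreier_regular : regular schreier_graph.
Proof.
move=> u [x b].
exists ((if b then act u (phi (letter (x, b))) else u), x, b); split.
  split=> //; case: b => //; rewrite /hat_origin /=.
  by rewrite -[LHS]actM -gmulfM letter_inv mulVg multiplicative1 act1.
move=> [[v y] c] [ou [yx cb]]; rewrite /= in yx cb; rewrite yx cb in ou *.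
congr (_, _, _); case: b ou {cb} => // ou.
by rewrite letter_inv multiplicativeV; apply/esym/actVK.
Qed.

(** Letters, inverted or not, act through phi, hence so do words.  The converse
follows since the graph is regular: some vertex is reached, and it can only be
the one given by the action. *)
Lemma schreier_reads (u v : vertex schreier_graph) (w : word X) :
  reads u w v <-> v = act u (phi (fg_of_word w)).
Proof.
have imp (u' v' : vertex schreier_graph) :
    reads u' w v' -> v' = act u' (phi (fg_of_word w)).
  elim: w u' => [|a w IH] u'.
    have -> : fg_of_word [::] = 1%g :> free_group X by apply: val_inj.
    by move=> /reads_nil ->; rewrite multiplicative1 act1.
  rewrite -cat1s => /reads_cat[t /reads_letterP[e [<- <- <-]] /IH ->].
  by rewrite fg_of_word_cons gmulfM actM schreier_terminus.
split=> [/imp //|->]; have [v' uv'] := regular_reads schreier_regular u w.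
by rewrite -(imp _ _ uv').
Qed.

Lemma schreier_fulfills : fulfills schreier_graph R.
Proof.
move=> u v p r Rr pp _ pr.
have /schreier_reads -> : reads u r v by exists p.
rewrite fg_of_word_val.
have -> : phi r = 1%g; last exact: act1.
have : normal_closure R r by exact: sub_gen_smallest Rr.
by rewrite -presG.2.
Qed.

Lemma schreier_connected :
  (forall u v, exists x, v = act u x) -> connected schreier_graph.
Proof.
move=> trans u v; have [x ->] := trans u v.
have [g _ <-] := presG.1 x I.
have /schreier_reads[p pp _] : act u (phi g) = act u (phi (fg_of_word g)).
  by rewrite fg_of_word_val.
by exists p.
Qed.

Lemma schreier_language (u : vertex schreier_graph) :
  phi @` language_fg u = [set x | act u x = u].
Proof.
have fS := regular_folded schreier_regular.
rewrite eqEsubset; split=> [_ [g Lg <-]|x /= xu].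
  have /(language_fgP fS)/schreier_reads := Lg.
  by rewrite fg_of_word_val.
have [g _ gx] := presG.1 x I; exists g => //; apply/(language_fgP fS).
by apply/schreier_reads; rewrite fg_of_word_val gx xu.
Qed.

End Schreier.

(** * The action on right cosets *)

Section CosetAction.
Variable H : set G.
Hypothesis subH : is_subgroup H.

Definition shift (C : set G) (x : G) : set G := [set c * x | c in C]%g.

Lemma shift1 C : shift C 1%g = C.
Proof.
rewrite eqEsubset; split=> [_ [c Cc <-]|c Cc]; first by rewrite mulg1.
by exists c => //; rewrite mulg1.
Qed.

Lemma shiftM C x y : shift C (x * y)%g = shift (shift C x) y.
Proof.
rewrite eqEsubset; split=> [_ [c Cc <-]|_ [_ [c Cc <-] <-]].
  by exists (c * x)%g; [exists c|rewrite mulgA].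
by exists c; rewrite ?mulgA.
Qed.

Lemma shift_coset C x : right_cosets H C -> right_cosets H (shift C x).
Proof. by move=> [y _ <-]; exists (y * x)%g => //; exact: shiftM. Qed.

Definition coset_act (C : right_cosets H) (x : G) : right_cosets H :=
  SigSub (mem_set (shift_coset x (set_valP C))).

Lemma coset_act1 C : coset_act C 1%g = C.
Proof. by apply: val_inj; exact: shift1. Qed.

Lemma coset_actM C x y :
  coset_act C (x * y)%g = coset_act (coset_act C x) y.
Proof. by apply: val_inj; exact: shiftM. Qed.

Lemma coset_act_transitive C D : exists x, D = coset_act C x.
Proof.
have [y _ yC] := set_valP C; have [z _ zD] := set_valP D.
exists (y^-1 * z)%g; apply: val_inj; rewrite /= -yC -zD.
by rewrite -[RHS]shiftM mulVKg.
Qed.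

Lemma base_cosetP : H \in right_cosets H.
Proof. by apply: mem_set; exists 1%g => //; exact: shift1. Qed.

Definition base_coset : right_cosets H := SigSub base_cosetP.

Lemma coset_act_stab : [set x | coset_act base_coset x = base_coset] = H.
Proof.
have [H1 HB] := (is_subgroupP _).1 subH.
have HV x : H x -> H (x^-1)%g by move=> Hx; rewrite -[(x^-1)%g]mul1g; apply: HB.
rewrite eqEsubset; split=> [x /(congr1 val)/= E|x Hx].
  by rewrite -E; exists 1%g => //; exact: mul1g.
apply: val_inj => /=; rewrite eqEsubset; split=> [_ [h Hh <-]|h Hh].
  by rewrite -[x]invgK; apply/HB/HV.
by exists (h / x)%g; [exact: HB|exact: mulgVK].
Qed.

End CosetAction.

Lemma relative_subgroup_graph_exists (n : nat) (H : set G) :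
  is_subgroup H -> has_index H n ->
  exists (Gam : xgraph X) (v0 : vertex Gam),
    is_relative_subgroup_graph R phi H n v0.
Proof.
move=> subH idxH.
have a1 := @coset_act1 H; have aM := @coset_actM H.
exists (schreier_graph (@coset_act H)), (base_coset H); split.
- split; first exact: schreier_regular.
  by apply: (schreier_connected a1 aM); exact: coset_act_transitive.
- exact: schreier_fulfills.
- exact: card_eq_trans (card_setT _) idxH.
- by rewrite (schreier_language a1 aM) coset_act_stab.
Qed.

End Presentation.

(** * The correspondence between subgroups and graphs *)

Theorem theorem3p5 (X : finType) (R : set (free_group X)) (G : groupType)
    (phi : {multiplicative free_group X -> G}) :
  is_presentation R phi ->
  (* (1) *)
  (forall (n : nat) (Gam : xgraph X) (v0 : vertex Gam),
     regular Gam -> connected Gam -> [set: vertex Gam] #= `I_n ->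
     fulfills Gam R ->
     is_subgroup (phi @` language_fg v0) /\
     has_index (phi @` language_fg v0) n) /\
  (* (2) *)
  (forall (n : nat) (H : set G), is_subgroup H -> has_index H n ->
     exists (Gam : xgraph X) (v0 : vertex Gam),
       is_relative_subgroup_graph R phi H n v0 /\
       (forall (Del : xgraph X) (w0 : vertex Del),
          is_relative_subgroup_graph R phi H n w0 ->
          exists! f, is_based_iso v0 w0 f)) /\
  (* Gamma_{X,R}(H) = Gamma_X(H') *)
  (forall (n : nat) (H : set G), is_subgroup H -> has_index H n ->
     forall (Gam : xgraph X) (v0 : vertex Gam),
       is_relative_subgroup_graph R phi H n v0 ->
       [/\ is_subgroup (language_fg v0),
           is_subgroup_graph (language_fg v0) v0 &
           forall (Del : xgraph X) (w0 : vertex Del),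
             is_subgroup_graph (language_fg v0) w0 ->
             exists f, is_based_iso v0 w0 f]).
Proof.
move=> pres.
have core_of n (Gam : xgraph X) (v : vertex Gam) : regular Gam ->
    connected Gam -> [set: vertex Gam] #= `I_n -> core v.
  move=> rG cG nG; apply: regular_core => //.
  by apply/finite_setP; exists n.
split; [|split].
- move=> n Gam v0 rG cG nG fulG; split; last exact: (index_language pres).
  exact/image_subgroup/language_subgroup/regular_folded.
- move=> n H subH idxH.
  have [Gam [v0 relG]] := relative_subgroup_graph_exists pres subH idxH.
  exists Gam, v0; split=> // Del w0 [[rD cD] fulD nD LD].
  have [[rG cG] fulG nG LG] := relG.
  have eqL : language_fg v0 = language_fg w0.
    rewrite (language_preimage pres rG fulG) LG.
    by rewrite [RHS](language_preimage pres rD fulD) LD.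
  have fG := regular_folded rG; have fD := regular_folded rD.
  have [f isof] := based_iso_of_language fG fD
    (core_of _ _ v0 rG cG nG) (core_of _ _ w0 rD cD nD) eqL.
  exists f; split=> // g [mg _ _]; have [mf _ _] := isof.
  exact: based_morphism_uniq mf mg.
- move=> n H _ _ Gam v0 [[rG cG] fulG nG _].
  have fG := regular_folded rG; have corG := core_of _ _ v0 rG cG nG.
  split; first exact: language_subgroup.
    by split=> //; exact: language_val.
  move=> Del w0 [fD _ corD LD]; apply: based_iso_of_language => //.
  apply/funext => g; rewrite -!(image_inj (f := val) val_inj).
  by rewrite -LD language_val.
Qed.
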